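(* Let $n\geq 0$. Every non-obtuse polyhedron in $\mathbb{S}^n$ is a simplex. Every non-obtuse polyhedron in $\mathbb{R}^n$ is a product of simplexes, i.e. up to an isometry of $\mathbb{R}^n$ it is of the form $\Delta_1\times\cdots\times\Delta_r \subset \mathbb{R}^{n_1}\times\cdots\times\mathbb{R}^{n_r}=\mathbb{R}^n$, where each $\Delta_i\subset\mathbb{R}^{n_i}$ is an $n_i$-simplex.
   Context: Let $\mathbb{X}^n$ be $\mathbb{R}^n$ or $\mathbb{S}^n\subset\mathbb{R}^{n+1}$. A half-space of $\mathbb{X}^n$ is a set $\{x\in\mathbb{X}^n : \langle v,x\rangle\leq a\}$ where $v\in\mathbb{R}^n$ (resp. $v\in\mathbb{R}^{n+1}$) has $\langle v,v\rangle=1$, and $a\in\mathbb{R}$ for $\mathbb{X}^n=\mathbb{R}^n$ while $a=0$ for $\mathbb{X}^n=\mathbb{S}^n$; $v$ is called its unit normal vector. A polyhedron in $\mathbb{X}^n$ is an intersection of finitely many half-spaces that has finite non-zero volume and, when $\mathbb{X}^n=\mathbb{S}^n$, is contained in the interior of some half-space. (For $n=0$ a polyhedron is a point; a point of $\mathbb{S}^0$ is itself a half-space, while $\mathbb{R}^0$ is an empty intersection of half-spaces.) A polyhedron $P$ is the intersection of a unique minimal set of half-spaces $H_1,\dots,H_k$, with unit normal vectors $v_1,\dots,v_k$. The Gram matrix of $P$ is the $k\times k$ matrix $G_{ij}=\langle v_i,v_j\rangle$. The polyhedron $P$ is non-obtuse if $G_{ij}\leq 0$ for all $i\neq j$. An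 $n$-simplex in $\mathbb{X}^n$ is a polyhedron that is the convex hull of $n+1$ points not contained in a hyperplane (in the spherical case the points lie in the interior of a half-space). *)

(* Defs.v *)
From HB Require Import structures.
From mathcomp Require Import all_boot all_order all_algebra.
From mathcomp Require Import all_classical all_reals all_analysis.
Import Order.TTheory GRing.Theory Num.Theory.
Import numFieldNormedType.Exports.

Set Implicit Arguments.
Unset Strict Implicit.
Unset Printing Implicit Defensive.

Local Open Scope classical_set_scope.
Local Open Scope ring_scope.

Definition dot (R : realType) (m : nat) (u v : 'rV[R]_m) : R :=
  \sum_(i < m) u 0 i * v 0 i.

Inductive geometry := Euclidean | Spherical.

(* Dimension of the vector space containing X^n. *)
Definition ambient (g : geometry) (n : nat) : nat :=
  if g is Spherical then n.+1 else n.

Definition space (R : realType) (g : geometry) (n : nat) :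
    set 'rV[R]_(ambient g n) :=
  if g is Spherical then [set x | dot x x = 1] else setT.

Definition admissible (R : realType) (g : geometry) (n : nat)
    (v : 'rV[R]_(ambient g n)) (a : R) : Prop :=
  dot v v = 1 /\ (if g is Spherical then a = 0 else True).

Definition halfspace (R : realType) (g : geometry) (n : nat)
    (v : 'rV[R]_(ambient g n)) (a : R) : set 'rV[R]_(ambient g n) :=
  [set x | @space R g n x /\ dot v x <= a].

Definition hyperplane (R : realType) (g : geometry) (n : nat)
    (v : 'rV[R]_(ambient g n)) (a : R) : set 'rV[R]_(ambient g n) :=
  [set x | @space R g n x /\ dot v x = a].

(* Topological interior of H relative to the subspace X. *)
Definition interior_in (T : topologicalType) (X H : set T) : set T :=
  [set x | X x /\ within X (nbhs x) H].

Definition in_open_halfspace (R : realType) (g : geometry) (n : nat)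
    (P : set 'rV[R]_(ambient g n)) : Prop :=
  exists (v : 'rV[R]_(ambient g n)) (a : R),
    admissible v a /\ P `<=` interior_in (@space R g n) (halfspace v a).

(* n-dimensional Lebesgue measure as the iterated product measure
   (volume of A = integral of the volumes of its sections, as in the library's
   product_measure1); R^0 is a single point of volume 1. Only closed sets are
   measured below, so all the integrands are measurable. *)
Fixpoint lebesgue_volume (R : realType) (n : nat) : set 'rV[R]_n -> \bar R :=
  match n return set 'rV[R]_n -> \bar R with
  | 0 => fun A => (\1_A 0)%:E
  | n'.+1 => fun A => (\int[@lebesgue_measure R]_t
      lebesgue_volume [set y : 'rV[R]_n' |
                        A (row_mx (const_mx t : 'rV[R]_1) y)])%E
  end.

Definition unit_cone (R : realType) (m : nat) (A : set 'rV[R]_m) : set 'rV[R]_m :=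
  [set y | exists (t : R) (x : 'rV[R]_m), [/\ 0 <= t, t <= 1, A x & y = t *: x]].

(* The surface measure of A in S^n is n+1 times the Lebesgue measure of the
   cone over A with apex 0; for n = 0 this is the counting measure. *)
Definition volume (R : realType) (g : geometry) (n : nat) :
    set 'rV[R]_(ambient g n) -> \bar R :=
  match g return set 'rV[R]_(ambient g n) -> \bar R with
  | Euclidean => @lebesgue_volume R n
  | Spherical => fun A =>
      (n.+1%:R%:E * @lebesgue_volume R n.+1 (unit_cone A))%E
  end.

Definition halfspaces_inter (R : realType) (g : geometry) (n k : nat)
    (v : 'I_k -> 'rV[R]_(ambient g n)) (a : 'I_k -> R) (J : set 'I_k) :
    set 'rV[R]_(ambient g n) :=
  @space R g n `&` \bigcap_(i in J) halfspace (v i) (a i).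

Definition presents (R : realType) (g : geometry) (n k : nat)
    (P : set 'rV[R]_(ambient g n))
    (v : 'I_k -> 'rV[R]_(ambient g n)) (a : 'I_k -> R) : Prop :=
  (forall i, admissible (v i) (a i)) /\ P = halfspaces_inter v a setT.

Definition polyhedron (R : realType) (g : geometry) (n : nat)
    (P : set 'rV[R]_(ambient g n)) : Prop :=
  [/\ exists (k : nat) (v : 'I_k -> 'rV[R]_(ambient g n)) (a : 'I_k -> R),
        presents P v a,
      (0 < volume P)%E, (volume P < +oo)%E
    & if g is Spherical then in_open_halfspace P else True].

Definition presents_minimally (R : realType) (g : geometry) (n k : nat)
    (P : set 'rV[R]_(ambient g n))
    (v : 'I_k -> 'rV[R]_(ambient g n)) (a : 'I_k -> R) : Prop :=
  presents P v a /\
  forall J : set 'I_k, P = halfspaces_inter v a J -> J = setT.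

Definition gram (R : realType) (m k : nat) (v : 'I_k -> 'rV[R]_m) : 'M[R]_k :=
  \matrix_(i < k, j < k) dot (v i) (v j).

(* A polyhedron has exactly one minimal set of half-spaces, so the choice of
   the minimal presentation matters only up to reindexing. *)
Definition nonobtuse (R : realType) (g : geometry) (n : nat)
    (P : set 'rV[R]_(ambient g n)) : Prop :=
  exists (k : nat) (v : 'I_k -> 'rV[R]_(ambient g n)) (a : 'I_k -> R),
    presents_minimally P v a /\ forall i j, i != j -> gram v i j <= 0.

(* In S^n the hull of points of an open hemisphere consists of the points of
   S^n in the convex cone that they span, hence no normalization there. *)
Definition convex_hull (R : realType) (g : geometry) (n k : nat)
    (p : 'I_k -> 'rV[R]_(ambient g n)) : set 'rV[R]_(ambient g n) :=
  [set x | @space R g n x /\ exists c : 'I_k -> R,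
    [/\ forall i, 0 <= c i,
        if g is Euclidean then \sum_i c i = 1 else True
      & x = \sum_i c i *: p i]].

Definition simplex (R : realType) (g : geometry) (n : nat)
    (P : set 'rV[R]_(ambient g n)) : Prop :=
  polyhedron P /\
  exists p : 'I_n.+1 -> 'rV[R]_(ambient g n),
    [/\ range p `<=` @space R g n,
        ~ (exists (v : 'rV[R]_(ambient g n)) (a : R),
             admissible v a /\ range p `<=` hyperplane v a),
        if g is Spherical then in_open_halfspace (range p) else True
      & P = convex_hull p].

Definition euclidean_isometry (R : realType) (n : nat)
    (f : 'rV[R]_n -> 'rV[R]_n) : Prop :=
  bijective f /\
  forall x y, Num.sqrt (dot (f x - f y) (f x - f y))
            = Num.sqrt (dot (x - y) (x - y)).

(* The product of the D i in R^(d_0) x ... x R^(d_(r-1)) = R^n: the consecutive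
   blocks of coordinates of a vector are its submxrow's. *)
Definition block_product (R : realType) (n r : nat) (d : 'I_r -> nat)
    (e : (\sum_(i < r) d i)%N = n) (D : forall i, set 'rV[R]_(d i)) :
    set 'rV[R]_n :=
  [set castmx (erefl 1%N, e) x | x in
    [set x : 'rV[R]_(\sum_(i < r) d i)%N | forall i, D i (submxrow x i)]].

(* Main.v *)
(** A dependence [\sum_i l_i v_i = 0] between vectors with pairwise nonpositive
    products remains one when each [l_i] is replaced by [|l_i|], because this
    can only decrease the squared norm of the sum.  Hence the support of a
    dependence is a union of connected components of the graph of
    non-orthogonality, and dependences restrict to components.

    In S^n an interior point [x0] has [<v_i, x0> < 0] for all [i], so that there
    is no dependence; as the polyhedron contains no antipodal points, the [v_i]
    span, hence form a basis, and the vertices are the normalized dual basis.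

    In R^n finite volume excludes nonzero recession directions [z]
    ([<v_i, z> <= 0] for all [i]).  A component without dependence would give
    one by the Fredholm alternative.  So each component carries, up to scaling,
    exactly one dependence, with positive coefficients: its half-spaces bound a
    simplex in the span of the component, and distinct components span
    orthogonal subspaces. *)

Require Import Defs.
From HB Require Import structures.
From mathcomp Require Import all_boot all_order all_algebra.
From mathcomp Require Import all_classical all_reals all_analysis.
From mathcomp Require Import ring lra.
Import Order.TTheory GRing.Theory Num.Theory.
Import numFieldNormedType.Exports.

Set Implicit Arguments.
Unset Strict Implicit.
Unset Printing Implicit Defensive.

Local Open Scope classical_set_scope.
Local Open Scope ring_scope.

(** * Lebesgue volume *)

Section LebesgueVolume.
Context {R : realType}.
Local Notation mu := (@lebesgue_measure R).
Local Open Scope ereal_scope.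

(* Holds without measurability: the integral of a nonnegative function is a
   supremum over the simple functions below it. *)
Lemma ge0_le_integralT (f g : R -> \bar R) :
  (forall x, 0 <= f x) -> (forall x, f x <= g x) ->
  \int[mu]_x f x <= \int[mu]_x g x.
Proof.
move=> f0 fg.
rewrite !ge0_integralTE//; last by move=> x; exact: le_trans (f0 x) (fg x).
by apply: ereal_sup_le => _ [h hf <-]; exists h => // x; exact: le_trans (fg x).
Qed.

Lemma lebesgue_volume_ge0 n (A : set 'rV[R]_n) : 0 <= lebesgue_volume A.
Proof.
elim: n A => [|n IH] A /=; first by rewrite lee_fin indicE; case: (_ \in _).
by apply: integral_ge0 => t _; exact: IH.
Qed.

Lemma lebesgue_volume0 n : lebesgue_volume (@set0 'rV[R]_n) = 0.
Proof.
elim: n => [|n IH] /=; first by rewrite indicE in_set0.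
by rewrite integral0_eq// => t _; exact: IH.
Qed.

Lemma lebesgue_volume_lower n (A : set 'rV[R]_n.+1) (D : set R) (c : \bar R) :
  measurable D -> 0 <= c ->
  (forall t, D t ->
    c <= lebesgue_volume [set y : 'rV_n | A (row_mx (const_mx t : 'rV_1) y)]) ->
  c * mu D <= lebesgue_volume A.
Proof.
move=> mD c0 h; rewrite -integral_cst// integral_mkcond /=.
apply: ge0_le_integralT => t; rewrite patchE.
  by case: ifP.
by case: ifP => [/set_mem/h//|_]; exact: lebesgue_volume_ge0.
Qed.

Lemma lebesgue_volume_upper n (A : set 'rV[R]_n.+1) (D : set R) (c : \bar R) :
  measurable D ->
  (forall t y, A (row_mx (const_mx t : 'rV_1) y) -> D t) ->
  (forall t, D t ->
    lebesgue_volume [set y : 'rV_n | A (row_mx (const_mx t : 'rV_1) y)] <= c) ->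
  lebesgue_volume A <= c * mu D.
Proof.
move=> mD AD h; rewrite -integral_cst// integral_mkcond /=.
apply: ge0_le_integralT => t; first exact: lebesgue_volume_ge0.
rewrite patchE; case: ifP => [/set_mem/h//|/negbT/negP nD].
rewrite (_ : [set y | _] = set0) ?lebesgue_volume0//.
by rewrite -subset0 => y /= /AD /mem_set.
Qed.

Lemma dot_row_const_mx n (a : 'rV[R]_1) (t : R) (u v : 'rV[R]_n) :
  dot (row_mx a u) (row_mx (const_mx t) v) = (a ord0 ord0 * t + dot u v)%R.
Proof.
rewrite /dot big_split_ord big_ord1 /= !row_mxEl mxE; congr (_ + _)%R.
by apply: eq_bigr => i _; rewrite !row_mxEr.
Qed.

(** Induction on [n]: if [v'] is nonzero, every slice lies in a hyperplane; otherwise at most one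
    slice is nonempty, and a single point of the line has measure zero. *)
Lemma lebesgue_volume_hyperplane n (A : set 'rV[R]_n) (v : 'rV[R]_n) (a : R) :
  (v != 0)%R -> (forall x, A x -> dot v x = a) -> lebesgue_volume A = 0.
Proof.
elim: n A v a => [|n IH] A v a; first by rewrite thinmx0 eqxx.
rewrite -(@hsubmxK _ 1 1 n v).
set v0 := lsubmx _; set v' := rsubmx _ => vn0 hA.
apply/eqP; rewrite eq_le lebesgue_volume_ge0 andbT.
have [v'0|v'n0] := eqVneq v' 0%R; last first.
  rewrite -[leRHS](mul0e (mu setT)).
  apply: lebesgue_volume_upper => // t _.
  rewrite (IH _ v' (a - v0 ord0 ord0 * t)%R)// => y /hA.
  by rewrite dot_row_const_mx => <-; rewrite addrAC subrr add0r.
have v0n0 : (v0 ord0 ord0 != 0)%R.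
  apply/eqP => v00; case/eqP: vn0; rewrite v'0 (_ : v0 = 0%R) ?row_mx0//.
  by apply/matrixP => i j; rewrite !ord1 [LHS]v00 mxE.
(* The exceptional slice may have infinite volume; the convention that [+oo] times 0 is 0 absorbs
   it. *)
have -> : 0 = +oo * mu [set (a / v0 ord0 ord0)%R].
  by rewrite lebesgue_measure_set1 mule0.
apply: lebesgue_volume_upper => // [t y /hA|t _]; last by rewrite leey.
rewrite dot_row_const_mx v'0 /= => <-; rewrite [dot _ _]big1 ?addr0.
  by rewrite mulrC mulKf.
by move=> i _; rewrite mxE mul0r.
Qed.

Lemma forall_row_mx n (P : R -> Prop) (a : 'rV[R]_1) (y : 'rV[R]_n) :
  P (a ord0 ord0) -> (forall i, P (y ord0 i)) ->
  forall i, P (row_mx a y ord0 i).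
Proof.
move=> Pa Py i; case: (split_ordP i) => j ->; last by rewrite (@row_mxEr _ 1 1 n).
by rewrite row_mxEl (ord1 j).
Qed.

(** Only the upper half of the range of each coordinate is integrated, hence [e] and not [2e] per
    factor; positivity is all that matters. *)
Lemma lebesgue_volume_cube_ge n (A : set 'rV[R]_n) (c : 'rV[R]_n) (e : R) :
  (0 < e)%R -> (forall y : 'rV[R]_n, (forall i, `|y 0 i| <= e)%R -> A (c + y)%R) ->
  ((e ^+ n)%R)%:E <= lebesgue_volume A.
Proof.
move=> e0; elim: n A c => [|n IH] A c hA.
  rewrite /= expr0 indicE mem_set//.
  by have := hA 0%R; rewrite (thinmx0 (c + _)%R); apply => -[].
rewrite exprSr EFinM.
have -> : e%:E = mu `[(c 0 ord0)%R, (c 0 ord0 + e)%R]%classic.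
  rewrite lebesgue_measure_itv /= lte_fin ltrDl e0 -EFinB.
  by rewrite addrC addKr.
apply: lebesgue_volume_lower => //.
  by rewrite lee_fin exprn_ge0// ltW.
move=> t /=; rewrite in_itv /= => /andP[t1 t2].
apply: (IH _ (@rsubmx _ 1 1 n c)) => y hy.
have := hA (@row_mx _ 1 1 n (const_mx (t - c 0 ord0)%R) y).
rewrite -{2}(@hsubmxK _ 1 1 n c) (@add_row_mx _ 1 1 n).
have -> : (@lsubmx _ 1 1 n c + const_mx (t - c 0 ord0) = const_mx t)%R.
  apply/matrixP => i j; rewrite !ord1 !mxE.
  rewrite (_ : lshift n (ord0 : 'I_1) = ord0 :> 'I_n.+1); last exact: val_inj.
  by rewrite addrC subrK.
apply; apply: (@forall_row_mx n (fun r => `|r| <= e)%R) => //.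
by rewrite mxE ler_norml; apply/andP; split; lra.
Qed.

Lemma lebesgue_volume_bounded n (A : set 'rV[R]_n) (M : R) :
  (forall x, A x -> forall i, `|x 0 i| <= M)%R -> lebesgue_volume A < +oo.
Proof.
(* A negative [M] forces [A] to be empty unless [n] is 0; the bound by the volume of a cube
   presupposes [M] nonnegative. *)
move=> hA; have [M0|M0] := ltP M 0%R.
  case: n A hA => [|n] A hA; first by rewrite /= ltry.
  rewrite (_ : A = set0) ?lebesgue_volume0// -subset0 => x /hA /(_ ord0).
  by move=> /(le_lt_trans)/(_ M0); rewrite normr_lt0.
suff : lebesgue_volume A <= (((M *+ 2) ^+ n)%R)%:E.
  by move=> /le_lt_trans; apply; rewrite ltry.
elim: n A hA => [|n IH] A hA.
  by rewrite /= lee_fin indicE expr0; case: (_ \in _); rewrite ?ler01.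
have [->|/set0P[x Ax]] := eqVneq A set0.
  by rewrite lebesgue_volume0 lee_fin exprn_ge0// mulrn_wge0.
rewrite exprSr EFinM.
have -> : (M *+ 2)%:E = mu `[(- M)%R, M]%classic.
  rewrite lebesgue_measure_itv /= lte_fin; case: ltP => [_|M1].
    by rewrite -EFinB opprK.
  by (have -> : M = 0%R by lra); rewrite mul0rn.
apply: lebesgue_volume_upper => // [t y /hA /(_ ord0)|t _].
  rewrite (_ : ord0 = lshift n (@ord0 0) :> 'I_n.+1); last exact: val_inj.
  by rewrite (@row_mxEl _ 1 1 n) mxE /= in_itv /= -ler_norml.
by apply: IH => y /hA h i; have := h (rshift 1 i); rewrite (@row_mxEr _ 1 1 n).
Qed.

(** [A] contains a tube around a ray. If the first coordinate of [z] is 0, the slices over an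
    interval contain tubes and are infinite by induction; otherwise the slices over a half-line
    contain cubes of one fixed size. *)
Lemma lebesgue_volume_ray n (A : set 'rV[R]_n) (c z : 'rV[R]_n) (e : R) :
  (0 < e)%R -> (z != 0)%R ->
  (forall (y : 'rV[R]_n) (t : R), (0 <= t)%R -> (forall i, `|y 0 i| <= e)%R ->
    A (c + y + t *: z)%R) ->
  lebesgue_volume A = +oo.
Proof.
move=> e0; elim: n A c z => [|n IH] A c z; first by rewrite thinmx0 eqxx.
rewrite -(@hsubmxK _ 1 1 n c) -(@hsubmxK _ 1 1 n z).
set c0 := @lsubmx _ 1 1 n c; set c' := @rsubmx _ 1 1 n c.
set z0 := @lsubmx _ 1 1 n z; set z' := @rsubmx _ 1 1 n z.
move=> zn0 hA; apply/eqP; rewrite -leye_eq.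
have [z00|z0n0] := eqVneq z0 0%R.
  have -> : +oo = +oo * mu `[(c0 0 ord0)%R, (c0 0 ord0 + e)%R]%classic.
    rewrite lebesgue_measure_itv /= lte_fin ltrDl e0 -EFinB.
    by rewrite addrC addKr gt0_mulye// lte_fin.
  apply: lebesgue_volume_lower => // t /=; rewrite in_itv /= => /andP[t1 t2].
  rewrite (IH _ c' z')//.
    by apply/eqP => z'0; case/eqP: zn0; rewrite z00 z'0 row_mx0.
  move=> y s s0 hy /=.
  have := hA (@row_mx _ 1 1 n (const_mx (t - c0 0 ord0)%R) y) s s0.
  rewrite (@scale_row_mx _ 1 1 n) !(@add_row_mx _ 1 1 n).
  have -> : (c0 + const_mx (t - c0 0 ord0) + s *: z0 = const_mx t)%R.
    apply/matrixP => i j; rewrite z00 scaler0 addr0 !ord1 [LHS]mxE [X in (_ + X)%R]mxE.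
    by rewrite [RHS]mxE; lra.
  apply; apply: (@forall_row_mx n (fun r => `|r| <= e)%R) => //.
  by rewrite mxE ler_norml; apply/andP; split; lra.
set w := z0 ord0 ord0.
have wn0 : (w != 0)%R.
  apply/eqP => w0; case/eqP: z0n0; apply/matrixP => i j.
  by rewrite !ord1 [LHS]w0 mxE.
(* The axis of the tube reaches first coordinate [t] at parameter [(t - c0) / w]. *)
have hsec t : (0 <= (t - c0 ord0 ord0) / w)%R -> ((e ^+ n)%R)%:E <=
    lebesgue_volume [set y : 'rV_n | A (row_mx (const_mx t : 'rV_1) y)].
  move=> t0; apply: (@lebesgue_volume_cube_ge n _
    (c' + ((t - c0 ord0 ord0) / w) *: z')%R e e0) => y hy /=.
  have := hA (@row_mx _ 1 1 n 0%R y) _ t0.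
  rewrite (@scale_row_mx _ 1 1 n) !(@add_row_mx _ 1 1 n).
  have -> : (c0 + 0 + ((t - c0 ord0 ord0) / w) *: z0 = const_mx t)%R.
    apply/matrixP => i j; rewrite addr0 !ord1 [LHS]mxE [X in (_ + X)%R]mxE [RHS]mxE.
    by rewrite -/w divfK// addrC subrK.
  rewrite addrAC; apply; apply: (@forall_row_mx n (fun r => `|r| <= e)%R) => //.
  by rewrite mxE normr0 ltW.
have en0 : (0 < (e ^+ n)%R%:E) by rewrite lte_fin exprn_gt0.
have [w0|w0] := ltP 0%R w.
  have -> : +oo = (e ^+ n)%R%:E * mu `[c0 ord0 ord0, +oo[%classic.
    by rewrite lebesgue_measure_itv /= ltry /= gt0_muley.
  apply: lebesgue_volume_lower => //; first exact: ltW.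
  move=> t /=; rewrite in_itv /= andbT => ct; apply: hsec.
  by rewrite divr_ge0 ?subr_ge0// ltW.
have -> : +oo = (e ^+ n)%R%:E * mu `]-oo, c0 ord0 ord0]%classic.
  by rewrite lebesgue_measure_itv /= ltNyr /= gt0_muley.
apply: lebesgue_volume_lower => //; first exact: ltW.
move=> t /=; rewrite in_itv /= => ct; apply: hsec.
by rewrite mulr_le0 ?invr_le0 ?subr_le0.
Qed.

End LebesgueVolume.

(** * Linear algebra in Euclidean coordinates *)

Section DotProduct.
Context {R : realType}.

Lemma dotE n (u v : 'rV[R]_n) : dot u v = (u *m v^T) 0 0.
Proof. by rewrite mxE; apply: eq_bigr => i _; rewrite mxE. Qed.

Lemma dotC n (u v : 'rV[R]_n) : dot u v = dot v u.
Proof. by apply: eq_bigr => i _; rewrite mulrC. Qed.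

Lemma dotDr n (u v w : 'rV[R]_n) : dot u (v + w) = dot u v + dot u w.
Proof. by rewrite !dotE linearD mulmxDr mxE. Qed.

Lemma dotZr n (u v : 'rV[R]_n) a : dot u (a *: v) = a * dot u v.
Proof. by rewrite !dotE linearZ -scalemxAr mxE. Qed.

Lemma dot0r n (u : 'rV[R]_n) : dot u 0 = 0.
Proof. by rewrite dotE trmx0 mulmx0 mxE. Qed.

Lemma dotZl n (u v : 'rV[R]_n) a : dot (a *: u) v = a * dot u v.
Proof. by rewrite dotC dotZr dotC. Qed.

Lemma dotDl n (u v w : 'rV[R]_n) : dot (u + v) w = dot u w + dot v w.
Proof. by rewrite dotC dotDr !(dotC w). Qed.

Lemma dotNr n (u v : 'rV[R]_n) : dot u (- v) = - dot u v.
Proof. by rewrite -scaleN1r dotZr mulN1r. Qed.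

Lemma dotBr n (u v w : 'rV[R]_n) : dot u (v - w) = dot u v - dot u w.
Proof. by rewrite dotDr dotNr. Qed.

Lemma dot_sumr n (I : Type) (r : seq I) (P : pred I) (F : I -> 'rV[R]_n) u :
  dot u (\sum_(i <- r | P i) F i) = \sum_(i <- r | P i) dot u (F i).
Proof.
by apply: (big_morph (dot u)) => [x y|]; rewrite ?dotDr ?dot0r.
Qed.

Lemma dot_suml n (I : Type) (r : seq I) (P : pred I) (F : I -> 'rV[R]_n) u :
  dot (\sum_(i <- r | P i) F i) u = \sum_(i <- r | P i) dot (F i) u.
Proof. by rewrite dotC dot_sumr; apply: eq_bigr => i _; rewrite dotC. Qed.

Lemma dot_mulmx m n (u : 'rV[R]_m) (A : 'M[R]_(m, n)) (v : 'rV[R]_n) :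
  dot (u *m A) v = dot u (v *m A^T).
Proof. by rewrite !dotE trmx_mul trmxK mulmxA. Qed.

Lemma dot_ge0 n (u : 'rV[R]_n) : 0 <= dot u u.
Proof. by apply: sumr_ge0 => i _; rewrite -expr2 sqr_ge0. Qed.

Lemma dot_eq0 n (u : 'rV[R]_n) : dot u u = 0 -> u = 0.
Proof.
move=> /eqP; rewrite psumr_eq0 => [/allP h|i _]; last by rewrite -expr2 sqr_ge0.
apply/rowP => i; have := h i (mem_index_enum _); rewrite /= -expr2 sqrf_eq0.
by move=> /eqP ->; rewrite mxE.
Qed.

Lemma dot_gt0 n (u : 'rV[R]_n) : u != 0 -> 0 < dot u u.
Proof.
move=> u0; rewrite lt_neqAle dot_ge0 andbT eq_sym.
by apply: contra_neq u0; exact: dot_eq0.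
Qed.

Lemma dot_normalize n (u : 'rV[R]_n) :
  u != 0 -> dot ((Num.sqrt (dot u u))^-1 *: u) ((Num.sqrt (dot u u))^-1 *: u) = 1.
Proof.
move=> u0; rewrite dotZl dotZr mulrA -invfM -expr2 sqr_sqrtr ?dot_ge0//.
by rewrite mulVf// gt_eqF// dot_gt0.
Qed.

(** A row lies in the row space of [V^T] once [cokermx V^T] annihilates it, and the columns of that
    cokernel are dependences between the [v i]. *)
Lemma fredholm k n (v : 'I_k -> 'rV[R]_n) (s : 'I_k -> R) :
  (forall l : 'I_k -> R, \sum_i l i *: v i = 0 -> \sum_i l i * s i = 0) ->
  exists z, forall i, dot (v i) z = s i.
Proof.
move=> h; pose V := \matrix_i v i.
suff /submxP[z hz] : ((\row_i s i) <= V^T)%MS.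
  exists z => i; rewrite dotC dotE; move/rowP/(_ i): hz.
  rewrite !mxE => ->; apply: eq_bigr => j _.
  by rewrite !mxE.
rewrite submxE; apply/eqP/rowP => j; rewrite !mxE.
transitivity (\sum_i cokermx V^T i j * s i).
  by apply: eq_bigr => i _; rewrite mxE mulrC.
apply: h.
have : (cokermx V^T)^T *m V = 0.
  by apply: trmx_inj; rewrite trmx_mul trmxK mulmx_coker trmx0.
move/(congr1 (row j)); rewrite row_mul row0 mulmx_sum_row => E; rewrite -[RHS]E.
by apply: eq_bigr => i _; rewrite rowK !mxE.
Qed.

Lemma rank_separating k n (v : 'I_k -> 'rV[R]_n) :
  (forall z, (forall i, dot (v i) z = 0) -> z = 0) -> \rank (\matrix_i v i) = n.
Proof.
move=> vspan; rewrite -mxrank_tr; apply/eqP/inj_row_free => z zv.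
apply: vspan => i; rewrite dotC; move/rowP/(_ i): zv; rewrite !mxE => zv.
by rewrite -[RHS]zv; apply: eq_bigr => j _; rewrite !mxE.
Qed.

(** Gram-Schmidt: the first row is made orthogonal to an orthonormal basis [B] of the others, then
    normalized. *)
Lemma orthonormal_basis d n (A : 'M[R]_(d, n)) : row_free A ->
  exists B : 'M[R]_(d, n), B *m B^T = 1%:M /\ (A == B)%MS.
Proof.
elim: d A => [|d IH] A.
  by exists A; rewrite submx_refl [LHS]flatmx0 [RHS]flatmx0.
rewrite -(@vsubmxK _ 1 d n A); set a := usubmx _; set A' := dsubmx _ => Afree.
have [|B [BB AB]] := IH A'.
  apply/inj_row_free => w wA; have : row_mx (0 : 'M[R]_1) w = 0.
    apply: (row_free_inj Afree); rewrite mul0mx (@mul_row_col _ 1 1 d).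
    by rewrite mul0mx add0r.
  by move/(congr1 rsubmx); rewrite row_mxKr linear0.
pose u := a - a *m B^T *m B.
have uB : u *m B^T = 0.
  by rewrite mulmxBl -!mulmxA BB mulmx1 subrr.
have aE : a = u + a *m B^T *m B by rewrite subrK.
have A'B : (A' <= B)%MS by case/andP: AB.
have BA' : (B <= A')%MS by case/andP: AB.
(* If [u] vanished, [a] would lie in the span of the rows of [A'], against [Afree]. *)
have u0 : u != 0.
  apply/eqP => u0; case/submxP: BA' => T BT.
  have : row_mx (1 : 'M[R]_1) (- (a *m B^T *m T)) = 0.
    apply: (row_free_inj Afree); rewrite mul0mx (@mul_row_col _ 1 1 d).
    by rewrite mul1mx mulNmx -(mulmxA (a *m B^T) T A') -BT.
  move/(congr1 lsubmx).
  rewrite row_mxKl linear0 => /matrixP/(_ 0 0); rewrite !mxE eqxx.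
  by apply/eqP; rewrite oner_eq0.
pose s := (Num.sqrt (dot u u))^-1.
have s0 : s != 0.
  by rewrite invr_eq0 gt_eqF// sqrtr_gt0 dot_gt0.
exists (col_mx (s *: u) B); split.
  rewrite (@tr_col_mx _ 1 d) (@mul_col_row _ 1 d n 1 d) BB.
  have -> : s *: u *m B^T = 0 by rewrite -scalemxAl uB scaler0.
  have -> : B *m (s *: u)^T = 0.
    by apply: trmx_inj; rewrite trmx_mul trmxK -scalemxAl uB scaler0 trmx0.
  rewrite (_ : _ *m _ = 1%:M) -?scalar_mx_block//.
  apply/matrixP => i j; rewrite !ord1 -[LHS]dotE dot_normalize//.
  by rewrite mxE eqxx.
have su : (u <= s *: u)%MS by rewrite eqmx_scale.
apply/andP; split; rewrite (@col_mx_sub _ 1 d); apply/andP; split.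
- rewrite aE addmx_sub//.
    apply: submx_trans su _.
    by rewrite -(@addsmxE _ 1 d n) addsmxSl.
  apply: submx_trans (submxMl _ _) _.
  by rewrite -(@addsmxE _ 1 d n) addsmxSr.
- by apply: submx_trans A'B _; rewrite -(@addsmxE _ 1 d n) addsmxSr.
- apply: submx_trans (scalemx_sub _ (submx_refl _)) _.
  rewrite -(@addsmxE _ 1 d n) addmx_sub ?addsmxSl// -mulNmx.
  apply: submx_trans (submxMl _ _) _.
  by apply: submx_trans BA' _; rewrite addsmxSr.
- by apply: submx_trans BA' _; rewrite -(@addsmxE _ 1 d n) addsmxSr.
Qed.

End DotProduct.

(** * Dependences in a non-obtuse family *)

Section NonobtuseFamily.
Context {R : realType} {n k : nat}.
Variable v : 'I_k -> 'rV[R]_n.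
Hypothesis v_nonobtuse : forall i j, i != j -> dot (v i) (v j) <= 0.

Definition relation (l : 'I_k -> R) := \sum_i l i *: v i = 0.

Lemma relation_dot l u : relation l -> \sum_i l i * dot (v i) u = 0.
Proof.
move=> l0; transitivity (dot (\sum_i l i *: v i) u).
  by rewrite dot_suml; apply: eq_bigr => i _; rewrite dotZl.
by rewrite l0 dotC dot0r.
Qed.

(* The off-diagonal terms of the squared norm of [\sum_i l i *: v i] can only
   decrease when [l] is replaced by [`|l|]. *)
Lemma relation_norm l : relation l -> relation (fun i => `|l i|).
Proof.
move=> l0; apply: dot_eq0; apply/eqP; rewrite eq_le dot_ge0 andbT.
have dotE (m : 'I_k -> R) : dot (\sum_i m i *: v i) (\sum_i m i *: v i) =
    \sum_i \sum_j m i * m j * dot (v i) (v j).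
  rewrite dot_suml; apply: eq_bigr => i _; rewrite dot_sumr.
  by apply: eq_bigr => j _; rewrite dotZl dotZr mulrA.
have <- : dot (\sum_i l i *: v i) (\sum_i l i *: v i) = 0 by rewrite l0 dot0r.
rewrite !dotE; apply: ler_sum => i _; apply: ler_sum => j _.
have [->|ij] := eqVneq i j; first by rewrite -normrM ger0_norm// -expr2 sqr_ge0.
by rewrite ler_wnM2r ?v_nonobtuse// -normrM ler_norm.
Qed.

(** In the product of the relation with coefficients [|l h|] and [v j], the term [h = j] vanishes
    and the others are nonpositive; since they sum to 0, each is 0. *)
Lemma relation_support l i j :
  relation l -> l i != 0 -> l j = 0 -> dot (v i) (v j) = 0.
Proof.
move=> /relation_norm/(relation_dot (v j)) E li lj.
have le0 h : `|l h| * dot (v h) (v j) <= 0.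
  have [->|hj] := eqVneq h j; first by rewrite lj normr0 mul0r.
  by rewrite mulr_ge0_le0// v_nonobtuse.
move/eqP: E; rewrite -oppr_eq0 -sumrN psumr_eq0 => [/allP/(_ i)|h _].
  rewrite mem_index_enum /= oppr_eq0 mulf_eq0 normr_eq0 (negbTE li) /=.
  by move=> /(_ isT)/eqP.
by rewrite oppr_ge0.
Qed.

Definition adjacent (i j : 'I_k) := dot (v i) (v j) != 0.

Lemma adjacent_connect_sym : connect_sym adjacent.
Proof. by apply: sym_connect_sym => i j; rewrite /adjacent dotC. Qed.

(** A connected component is represented by its canonical root, so that components are compared as
    indices. *)
Local Notation component := (fingraph.root adjacent).

Lemma dot_component i j : component i != component j -> dot (v i) (v j) = 0.
Proof.
move=> ij; apply/eqP; apply: contraNT ij => h; apply/eqP.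
by apply/(fingraph.rootP adjacent_connect_sym); exact: connect1.
Qed.

(** The restricted sum is orthogonal to every vector outside the component, so its squared norm
    equals its product with the full sum, which is 0. *)
Lemma relation_component l c :
  relation l -> relation (fun i => if component i == c then l i else 0).
Proof.
move=> l0; apply: dot_eq0.
set u := \sum_i _; transitivity (dot u (\sum_i l i *: v i)); last first.
  by rewrite l0 dot0r.
rewrite /u !dot_suml; apply: eq_bigr => i _; rewrite !dotZl.
case: ifP => [/eqP ic|_]; last by rewrite !mul0r.
congr (_ * _); rewrite !dot_sumr; apply: eq_bigr => j _; rewrite !dotZr.
case: ifP => // /negbT jc; rewrite dot_component ?mulr0//.
by rewrite ic eq_sym.
Qed.

(** By [relation_support] the support is closed under adjacency, so on a component it is everything
    or empty. *)
Lemma relation_component_eq0 l c j : relation l ->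
  (forall i, component i != c -> l i = 0) -> component j = c -> l j = 0 ->
  forall i, l i = 0.
Proof.
move=> l0 lc jc lj i; have [ic|/lc//] := eqVneq (component i) c.
have cl : fingraph.closed adjacent [pred i | l i != 0].
  apply: (intro_closed adjacent_connect_sym) => x y xy; rewrite !inE => lx.
  apply: contraNneq xy => ly; apply/eqP; exact: relation_support ly.
have : connect adjacent i j by apply/(fingraph.rootP adjacent_connect_sym); rewrite ic.
by move/(closed_connect cl); rewrite !inE lj eqxx => /negbFE/eqP.
Qed.

Hypothesis v_bounded : forall z, (forall i, dot (v i) z <= 0) -> z = 0.

(** A nonzero relation on the component would be positive there after taking absolute values. If
    there is none, [fredholm] yields [z] with products -1 on the component and 0 elsewhere, which
    [v_bounded] forbids. *)
Lemma component_positive_relation c : component c = c ->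
  exists l, [/\ relation l, forall i, component i != c -> l i = 0
              & forall i, component i = c -> 0 < l i].
Proof.
move=> cc; apply: contrapT => no.
have l0 l : relation l -> (forall i, component i != c -> l i = 0) ->
    forall i, l i = 0.
  move=> rl lc; apply: contrapT => /existsNP[i li]; apply: no.
  exists (fun i => `|l i|); split; first exact: relation_norm.
    by move=> j /lc ->; rewrite normr0.
  move=> j jc; rewrite normr_gt0; apply/eqP => lj.
  by apply: li; exact: relation_component_eq0 jc lj i.
have [l rl|z hz] := @fredholm R k n v (fun i => if component i == c then -1 else 0).
  have := l0 _ (relation_component c rl).
  move=> h; apply: big1 => i _; case: ifP => ic; last by rewrite mulr0.
  have := h _ i; rewrite ic => ->; first by rewrite mul0r.
  by move=> j /negbTE ->.
have z0 : z = 0.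
  by apply: v_bounded => i; rewrite hz; case: ifP => // _; rewrite oppr_le0.
have := hz c; rewrite z0 dot0r cc eqxx => /eqP.
by rewrite eq_sym oppr_eq0 oner_eq0.
Qed.

End NonobtuseFamily.

(** * Polytopes and simplexes *)

Section Polytopes.
Context {R : realType}.

Definition polytope n k (v : 'I_k -> 'rV[R]_n) (a : 'I_k -> R) : set 'rV[R]_n :=
  [set x | forall i, dot (v i) x <= a i].

Lemma cube_in_polytope n k (v : 'I_k -> 'rV[R]_n) (a : 'I_k -> R) x0 :
  (forall i, dot (v i) x0 < a i) ->
  exists2 e : R, 0 < e & forall y : 'rV[R]_n, (forall j, `|y 0 j| <= e) ->
    polytope v a (x0 + y).
Proof.
(* [B i] exceeds the l1 norm of [v i], so it bounds the growth of [dot (v i)] on cubes; the summand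
   1 makes it positive. *)
move=> x0P; pose B i := 1 + \sum_j `|v i 0 j|.
have B0 i : 0 < B i by rewrite ltr_pwDl// sumr_ge0.
exists (\big[Num.min/1]_i ((a i - dot (v i) x0) / B i)).
  by apply: lt_bigmin => // i _; rewrite divr_gt0// subr_gt0.
set e := \big[_/_]_i _ => y ye i.
have e0 : 0 <= e.
  by apply/ltW/lt_bigmin => // j _; rewrite divr_gt0// subr_gt0.
have eB : e * B i <= a i - dot (v i) x0.
  by rewrite -ler_pdivlMr//; exact: bigmin_le.
rewrite dotDr -lerBrDl; apply: le_trans eB.
apply: le_trans (ler_norm _) _; apply: le_trans (ler_norm_sum _ _ _) _.
rewrite mulrDr mulr1 mulr_sumr.
apply: (@le_trans _ _ (\sum_j e * `|v i 0 j|)).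
  by apply: ler_sum => j _; rewrite normrM mulrC ler_wpM2r.
by rewrite lerDr.
Qed.

Lemma polytope_volume_gt0 n k (v : 'I_k -> 'rV[R]_n) (a : 'I_k -> R) x0 :
  (forall i, dot (v i) x0 < a i) ->
  (0 < lebesgue_volume (polytope v a))%E.
Proof.
move=> /cube_in_polytope[e e0 he].
apply: lt_le_trans (lebesgue_volume_cube_ge e0 he).
by rewrite lte_fin exprn_gt0.
Qed.

Lemma polytope_recession n k (v : 'I_k -> 'rV[R]_n) (a : 'I_k -> R) x0 z :
  (forall i, dot (v i) x0 < a i) -> (forall i, dot (v i) z <= 0) ->
  (lebesgue_volume (polytope v a) < +oo)%E -> z = 0.
Proof.
move=> /cube_in_polytope[e e0 he] vz; apply: contraPP => /eqP z0.
rewrite (lebesgue_volume_ray (c := x0) e0 z0) ?ltxx// => y t t0 /he ye i.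
by rewrite dotDr dotZr (le_trans _ (ye i))// gerDl mulr_ge0_le0.
Qed.

(** The slacks [a i - dot (w i) x], weighted by [m], have the same sum [S] at every [x]; divided by
    [S] they are the barycentric coordinates of [x]. *)
Lemma simplex_euclidean d (w : 'I_d.+1 -> 'rV[R]_d) (a m : 'I_d.+1 -> R) y0 :
  (forall i, dot (w i) (w i) = 1) -> (forall i, 0 < m i) ->
  \sum_i m i *: w i = 0 -> (forall z, (forall i, dot (w i) z = 0) -> z = 0) ->
  (forall i, dot (w i) y0 < a i) ->
  @simplex R Euclidean d (polytope w a).
Proof.
move=> w1 m0 mw wspan y0a.
have mdot x : \sum_i m i * dot (w i) x = 0 by exact: (relation_dot x mw).
set D := polytope w a; pose S := \sum_i m i * a i.
have S0 : 0 < S.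
  rewrite -(mdot y0) -subr_gt0 -sumrB (bigD1 ord0)//= ltr_pwDl//.
    by rewrite -mulrBr mulr_gt0// subr_gt0.
  by apply: sumr_ge0 => i _; rewrite -mulrBr mulr_ge0 ?subr_ge0 ?ltW.
pose W := \matrix_i w i.
(* The [d.+1] vectors span a space of dimension [d], so their dependences form a line. *)
have relE l : \sum_i l i *: w i = 0 -> exists t, forall i, l i = t * m i.
  have rowE (f : 'I_d.+1 -> R) : (\row_i f i) *m W = \sum_i f i *: w i.
    by rewrite mulmx_sum_row; apply: eq_bigr => i _; rewrite rowK mxE.
  have mn0 : \row_i m i != 0.
    by apply/eqP => /rowP/(_ ord0); rewrite !mxE => /eqP; rewrite gt_eqF.
  have rW : \rank W = d by exact: rank_separating.
  have mker : (\row_i m i <= kermx W)%MS by rewrite sub_kermx rowE mw.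
  have kerm : (kermx W <= \row_i m i)%MS.
    by rewrite -(mxrank_leqif_sup mker) mxrank_ker rW subSnn rank_rV mn0.
  move=> lw; have : (\row_i l i <= \row_i m i)%MS.
    by apply: submx_trans kerm; rewrite sub_kermx rowE lw.
  by move=> /sub_rVP[t tE]; exists t => i; move/rowP/(_ i): tE; rewrite !mxE.
(* [q j] is the vertex opposite facet [j]: all other inequalities are tight there, which forces the
   slack [S / m j] in the remaining one. *)
have /choice[q qE] : forall j, exists q, forall i,
    dot (w i) q = a i - (if i == j then S / m i else 0).
  move=> j; apply: fredholm => l /relE[t lE].
  transitivity (t * (S - m j * (S / m j))).
    rewrite mulrBr mulr_sumr (bigD1 j)//= [in RHS](bigD1 j)//= eqxx.
    rewrite lE mulrBr !mulrA addrAC; congr (_ - _).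
    congr (_ + _); apply: eq_bigr => i /negbTE ->.
    by rewrite lE subr0 mulrA.
  by rewrite mulrC mulrCA divff ?gt_eqF// mulr1 subrr mul0r.
pose c x j := (a j - dot (w j) x) * m j / S.
have c1 x : \sum_j c x j = 1.
  rewrite -mulr_suml (_ : \sum_j _ = S) ?divff ?gt_eqF//.
  rewrite -[RHS]subr0 -[X in _ - X](mdot x) -sumrB; apply: eq_bigr => i _.
  by rewrite -mulrBr mulrC.
have dotc (b : 'I_d.+1 -> R) i : \sum_j b j = 1 ->
    dot (w i) (\sum_j b j *: q j) = a i - b i * (S / m i).
  move=> b1; rewrite dot_sumr; under eq_bigr do rewrite dotZr qE mulrBr.
  rewrite sumrB -mulr_suml b1 mul1r; congr (_ - _).
  rewrite (bigD1 i)//= eqxx big1 ?addr0// => j; rewrite eq_sym => /negbTE ->.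
  by rewrite mulr0.
have xE x : x = \sum_j c x j *: q j.
  apply/eqP; rewrite -subr_eq0; apply/eqP; apply: wspan => i.
  rewrite dotBr dotc// mulrA divfK ?gt_eqF// mulfK ?gt_eqF//.
  by rewrite subKr subrr.
have DE : D = @convex_hull R Euclidean d _ q.
  apply/seteqP; split=> x /=.
    move=> xD; split=> //; exists (c x); split=> // i.
    by rewrite divr_ge0 ?mulr_ge0 ?subr_ge0 ?xD// ltW.
  move=> [_ [b [b0 b1 ->]]] i; rewrite dotc// gerBl.
  by rewrite mulr_ge0// divr_ge0 ?ltW.
have D0 : (0 < lebesgue_volume D)%E by exact: polytope_volume_gt0 y0a.
split.
  split=> //.
  - exists d.+1, w, a; split=> //; apply/seteqP; split=> x /=.
      by move=> xD; split=> // i _; split=> //; exact: xD.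
    by move=> [_ xD] i; case: (xD i I).
  - apply: (@lebesgue_volume_bounded _ _ _ (\sum_j \sum_i `|q j 0 i|)).
    rewrite DE => x [_ [b [b0 b1 ->]]] i; rewrite summxE.
    apply: le_trans (ler_norm_sum _ _ _) _; apply: ler_sum => j _.
    rewrite mxE normrM ger0_norm//.
    apply: (@le_trans _ _ `|q j 0 i|).
      rewrite ler_piMl// -b1 (bigD1 j)//= lerDl.
      by apply: sumr_ge0.
    by rewrite (bigD1 i)//= lerDl; apply: sumr_ge0.
exists q; split=> // -[u [b [[u1 _] qu]]].
(* Vertices in a common hyperplane would put their hull [D] in it, against its positive volume. *)
have u0 : u != 0.
  by apply/eqP => u0; move/eqP: u1; rewrite u0 dot0r eq_sym oner_eq0.
move: D0; rewrite DE (@lebesgue_volume_hyperplane _ _ _ u b)// ?ltxx//.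
move=> _ [_ [f [_ f1 ->]]]; rewrite dot_sumr -[b]mul1r -f1 mulr_suml.
apply: eq_bigr => i _; rewrite dotZr; congr (_ * _).
by have [] : hyperplane u b (q i) by apply: qu; exists i.
Qed.

End Polytopes.

(** * Orthogonal decomposition into components *)

Section Components.
Context {R : realType} {n k : nat}.
Variable v : 'I_k -> 'rV[R]_n.
Hypothesis v_unit : forall i, dot (v i) (v i) = 1.
Hypothesis v_nonobtuse : forall i j, i != j -> dot (v i) (v j) <= 0.
Hypothesis v_bounded : forall z, (forall i, dot (v i) z <= 0) -> z = 0.

Local Notation component := (fingraph.root (adjacent v)).

(** The rows of [B] are an orthonormal basis of the span of the component. Dimension and matrix are
    packed in one pair so that both can be chosen at once for all components. *)
Lemma component_simplex c (a : 'I_k -> R) x0 : component c = c ->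
  (forall i, dot (v i) x0 < a i) ->
  exists p : {d : nat & 'M[R]_(d, n)},
    let B := projT2 p in
    [/\ B *m B^T = 1%:M,
        forall z : 'rV[R]_n,
          (forall i, component i = c -> dot (v i) z = 0) -> z *m B^T = 0,
        forall i, component i = c -> v i *m B^T *m B = v i
      & @simplex R Euclidean (projT1 p) [set y | forall i, component i = c ->
          dot (v i *m B^T) y <= a i]].
Proof.
move=> cc x0a.
have [l [rl lc l0]] := component_positive_relation v_nonobtuse v_bounded cc.
(* Without [c] the component becomes independent: a dependence vanishing at [c] vanishes on all of
   it. So there is one more half-space than the dimension. *)
pose pr := [pred i | (component i == c) && (i != c)].
pose A := \matrix_(j < #|pr|) v (enum_val j).
have prP (j : 'I_#|pr|) : component (enum_val j) = c /\ enum_val j != c.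
  by have := enum_valP j; rewrite inE => /andP[/eqP].
have Afree : row_free A.
  apply/inj_row_free => w wA.
  pose l' i := \sum_(j < #|pr| | enum_val j == i) w 0 j.
  have l'E j : l' (enum_val j) = w 0 j.
    rewrite /l' (eq_bigl (pred1 j)) ?big_pred1_eq// => h /=.
    by rewrite (inj_eq enum_val_inj).
  have rl' : relation v l'.
    rewrite /relation -[RHS]wA [RHS]mulmx_sum_row.
    transitivity (\sum_i \sum_(j < #|pr| | enum_val j == i)
                    w 0 j *: v (enum_val j)).
      apply: eq_bigr => i _; rewrite scaler_suml.
      by apply: eq_bigr => j /eqP ->.
    rewrite (exchange_big_dep xpredT)//=; apply: eq_bigr => j _.
    by rewrite rowK (eq_bigl (pred1 (enum_val j))) ?big_pred1_eq.
  have l'0 i : ~~ pr i -> l' i = 0.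
    move=> ipr; apply: big1 => j /eqP ji; case/negP: ipr.
    by rewrite -ji /=; have [/eqP -> ->] := prP j.
  apply/rowP => j; rewrite mxE -l'E.
  apply: (relation_component_eq0 v_nonobtuse rl' _ cc).
    by move=> i /negbTE ic; apply: l'0; rewrite /= ic.
  by apply: l'0; rewrite /= eqxx andbF.
have [B [BB /andP[AB BA]]] := orthonormal_basis Afree.
have prB z : (forall i, component i = c -> dot (v i) z = 0) -> z *m B^T = 0.
  move=> vz; case/submxP: BA => T ->; rewrite trmx_mul mulmxA.
  suff -> : z *m A^T = 0 by rewrite mul0mx.
  apply/rowP => j; rewrite [RHS]mxE -[RHS](vz (enum_val j)); last by case: (prP j).
  by rewrite mxE dotC; apply: eq_bigr => h _; rewrite !mxE.
have vB0 i : pr i -> v i *m B^T *m B = v i.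
  move=> ipr; have /submxP[T ->] : (v i <= B)%MS.
    apply: submx_trans AB; rewrite -(enum_rankK_in ipr ipr).
    by rewrite -(rowK (fun j : 'I_#|pr| => v (enum_val j))) row_sub.
  by rewrite -!mulmxA (mulmxA B) BB mul1mx.
have vB i : component i = c -> v i *m B^T *m B = v i.
  have [-> _|ic /eqP icc] := eqVneq i c; last by apply: vB0; rewrite /= icc.
  (* The relation [l] expresses [v c] by the other vectors, on which the projection is the identity;
     [l c] is nonzero. *)
  have : \sum_i l i *: (v i *m B^T *m B - v i) = 0.
    under eq_bigr do rewrite scalerBr -mulmxA scalemxAl.
    by rewrite sumrB -mulmx_suml rl mul0mx subr0.
  rewrite (bigD1 c)//= big1 ?addr0 => [/eqP|h hc].
    by rewrite scaler_eq0 subr_eq0 gt_eqF ?l0// => /eqP.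
  have [hcc|/lc ->] := eqVneq (component h) c; last by rewrite scale0r.
  by rewrite vB0 ?subrr ?scaler0//= hcc eqxx.
exists (existT _ #|pr| B) => /=; split=> //.
pose g (j : 'I_#|pr|.+1) := oapp enum_val c (unlift ord0 j).
have gc j : component (g j) = c.
  by rewrite /g; case: (unlift _ _) => [h|//] /=; case: (prP h).
have gsurj i : component i = c -> exists j, g j = i.
  have [-> _|ic /eqP icc] := eqVneq i c; first by exists ord0; rewrite /g unlift_none.
  have ipr : i \in pr by rewrite inE icc.
  by exists (lift ord0 (enum_rank_in ipr i)); rewrite /g liftK /= enum_rankK_in.
rewrite (_ : [set y | _] = polytope (fun j => v (g j) *m B^T) (a \o g)).
  apply: (@simplex_euclidean _ _ _ _ (l \o g) (x0 *m B^T)).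
  - by move=> j; rewrite dot_mulmx trmxK vB.
  - by move=> j; rewrite l0.
  - under eq_bigr do rewrite scalemxAl.
    rewrite -mulmx_suml (_ : \sum_j _ = 0) ?mul0mx//.
    rewrite big_ord_recl /= /g unlift_none /=.
    under eq_bigr do rewrite liftK /=.
    rewrite -(big_enum_val (fun i => l i *: v i)) -[RHS]rl.
    rewrite [RHS](bigD1 c)//=; congr (_ + _).
    rewrite [RHS](bigID (fun i => component i == c)) /= [X in _ + X]big1.
      by rewrite addr0; apply: eq_bigl => i; rewrite inE andbC.
    by move=> i /andP[_ /lc ->]; rewrite scale0r.
  - move=> z zv; rewrite -[z]mulmx1 -BB mulmxA; apply: prB => i /gsurj[j <-].
    by rewrite dotC dot_mulmx dotC zv.
  - by move=> j; rewrite dotC dot_mulmx trmxK vB// dotC.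
apply/seteqP; split=> y /= yD; first by move=> j; apply: yD.
by move=> i /gsurj[j <-]; exact: yD.
Qed.

End Components.

(** The stacked matrix [M] has orthonormal rows, and these span the space, so [M] is orthogonal; the
    isometry takes coordinates with respect to its rows. *)
Lemma orthonormal_blocks (R : realType) n r (d : 'I_r -> nat)
    (B : forall c, 'M[R]_(d c, n)) :
  (forall c, B c *m (B c)^T = 1%:M) ->
  (forall c c', c != c' -> B c *m (B c')^T = 0) ->
  (forall z : 'rV[R]_n, (forall c, z *m (B c)^T = 0) -> z = 0) ->
  exists f (e : (\sum_(i < r) d i)%N = n), @euclidean_isometry R n f /\
    forall D : forall c, set 'rV[R]_(d c),
      [set f x | x in [set x | forall c, D c (x *m (B c)^T)]] = block_product e D.
Proof.
move=> B1 B0 Bspan; pose M := \mxcol_c B c.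
have MM : M *m M^T = 1%:M.
  rewrite tr_mxcol mul_mxcol_mxrow -(mxdiagZ 1); apply/eq_mxblockP => c c'.
  case: eqVneq => [<-|]; first by rewrite conform_mx_id B1.
  exact: B0.
have MT : M^T = \mxrow_c (B c)^T by rewrite tr_mxcol.
have e : (\sum_(i < r) d i)%N = n.
  have : row_free M by apply/row_freeP; exists M^T.
  have : row_free M^T.
    apply/inj_row_free => z; rewrite MT mul_mxrow => zB; apply: Bspan => c.
    by move/(congr1 (fun A => submxrow A c)): zB; rewrite mxrowK submxrow0.
  by rewrite /row_free mxrank_tr => /eqP -> /eqP.
(* Replacing [n] by the sum of the dimensions makes [M] square and the cast trivial. *)
clearbody M; subst n; have MM' := mulmx1C MM.
exists (fun x => x *m M^T), erefl; split.
  split; last first.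
    move=> x y; rewrite -mulmxBl dot_mulmx trmxK.
    by rewrite -mulmxA MM' mulmx1.
  by exists (fun y => y *m M) => x; rewrite -mulmxA ?MM ?MM' mulmx1.
move=> D; apply/seteqP; split=> _ [x xD <-].
  exists (x *m M^T); last by rewrite castmx_id.
  by move=> c; rewrite MT mul_mxrow mxrowK.
exists (x *m M); last by rewrite castmx_id -mulmxA MM mulmx1.
move=> c; rewrite /= -[(B c)^T](mxrowK (fun c => (B c)^T)) -MT.
by rewrite mul_submxrow -mulmxA MM mulmx1; exact: xD.
Qed.

(** No bounding hyperplane contains [A], so each inequality is strict at some point of [A]; the
    average of these points satisfies all of them strictly. *)
Lemma polytope_interior (R : realType) n k (v : 'I_k -> 'rV[R]_n) a A :
  (forall i, v i != 0) -> A `<=` polytope v a -> (0 < lebesgue_volume A)%E ->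
  exists x0, forall i, dot (v i) x0 < a i.
Proof.
move=> v0 AP A0.
have /set0P[p Ap] : A != set0.
  by apply/eqP => A00; move: A0; rewrite A00 lebesgue_volume0 ltxx.
have /choice[x xE] : forall i, exists x, A x /\ dot (v i) x < a i.
  move=> i; apply: contrapT => no; move: A0.
  rewrite (@lebesgue_volume_hyperplane _ _ _ (v i) (a i))// ?ltxx// => x Ax.
  apply/eqP; rewrite eq_le AP//= leNgt; apply/negP => xa.
  by apply: no; exists x.
(* The additional point [p] keeps the average meaningful for [k = 0]. *)
exists (k.+1%:R^-1 *: (p + \sum_j x j)) => i.
rewrite dotZr mulrC ltr_pdivrMr ?ltr0n// dotDr dot_sumr mulr_natr mulrS.
rewrite ler_ltD ?AP// (bigD1 i)//=.
have -> : a i *+ k = a i + \sum_(j < k | j != i) a i.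
  by rewrite -[in LHS](card_ord k) -sumr_const (bigD1 i).
apply: ltr_leD; first by case: (xE i).
by apply: ler_sum => j _; apply: AP; case: (xE j).
Qed.

(** * The spherical and Euclidean cases *)

(** From a point of the boundary great sphere, an arbitrarily short move towards [w] along a great
    circle leaves the half-space. *)
Lemma open_halfspace_lt0 (R : realType) n (w : 'rV[R]_n.+1) x :
  dot w w = 1 ->
  interior_in (@Defs.space R Spherical n) (@halfspace R Spherical n w 0) x ->
  dot w x < 0.
Proof.
move=> w1 [/= x1 xH]; rewrite ltNge; apply/negP => wx0.
have wx : dot w x = 0.
  by apply/eqP; rewrite eq_le wx0 andbT; case: (nbhs_singleton xH x1).
(* The rational parametrization of the half-circle from [x] through [w]. *)
pose y (t : R) := (1 + t ^+ 2)^-1 *: ((1 - t ^+ 2) *: x + (2 * t) *: w).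
have t0 (t : R) : 1 + t ^+ 2 != 0 by rewrite gt_eqF// ltr_pwDl// sqr_ge0.
have yx : y t @[t --> (0 : R)] --> x.
  rewrite (_ : x = y 0) /y; last first.
    by rewrite expr0n mulr0 addr0 subr0 invr1 scale0r addr0 !scale1r.
  have ct2 : (fun t : R => t ^+ 2) @ (0 : R) --> (0 : R) ^+ 2.
    exact: (@exprn_continuous R 2 0).
  apply: cvgZ; first by apply: cvgV; [exact: t0|apply: cvgD => //; exact: cvg_cst].
  apply: cvgD; (apply: cvgZ; last exact: cvg_cst).
    by apply: cvgB => //; exact: cvg_cst.
  by apply: cvgM; [exact: cvg_cst|exact: cvg_id].
have xH0 : \forall t \near (0 : R), @Defs.space R Spherical n (y t) ->
    @halfspace R Spherical n w 0 (y t) by exact: yx xH.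
have [t [ht tgt0]] : exists t : R, (@Defs.space R Spherical n (y t) ->
    @halfspace R Spherical n w 0 (y t)) /\ 0 < t.
  apply: (@filter_ex _ _ (at_right_proper_filter (0 : R))).
  by apply: filterI; [exact: cvg_within xH0|exact: nbhs_right_gt].
have xw : dot x w = 0 by rewrite dotC.
have yt1 : dot (y t) (y t) = 1.
  rewrite /y !(dotZl, dotZr, dotDl, dotDr) x1 w1 wx xw.
  by field; exact: t0.
have [_] := ht yt1.
rewrite /y dotZr dotDr !dotZr wx w1 mulr0 add0r mulr1 leNgt.
by rewrite mulr_gt0 ?invr_gt0 ?mulr_gt0// ltr_pwDl// sqr_ge0.
Qed.

Theorem theorem10 (R : realType) (n : nat) :
  (forall P : set 'rV[R]_n.+1,
     @polyhedron R Spherical n P -> @nonobtuse R Spherical n P ->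
     @simplex R Spherical n P) /\
  (forall P : set 'rV[R]_n,
     @polyhedron R Euclidean n P -> @nonobtuse R Euclidean n P ->
     exists f : 'rV[R]_n -> 'rV[R]_n,
       euclidean_isometry f /\
       exists (r : nat) (d : 'I_r -> nat) (e : (\sum_(i < r) d i)%N = n)
              (D : forall i : 'I_r, set 'rV[R]_(d i)),
         (forall i, @simplex R Euclidean (d i) (D i)) /\
         [set f x | x in P] = block_product e D).
Proof.
have unit_neq0 m (u : 'rV[R]_m) : dot u u = 1 -> u != 0.
  by move=> u1; apply/eqP => u0; move/eqP: u1; rewrite u0 dot0r eq_sym oner_eq0.
split=> P Ppoly [k [v [a [[[va PE] _] vG]]]].

  (* The spherical case *)
  have v1 i : dot (v i) (v i) = 1 by case: (va i).
  have a0 : a = fun=> 0 by apply/funext => i; case: (va i).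
  have vno i j : i != j -> dot (v i) (v j) <= 0 by move/vG; rewrite mxE.
  have PP x : P x <-> dot x x = 1 /\ forall i, dot (v i) x <= 0.
    rewrite PE a0; split=> [[x1 xP]|[x1 xP]].
      by split=> // i; case: (xP i I).
    by split=> // i _; split=> //; exact: xP.
  case: (Ppoly) => _ volP _ [w [b [[w1 b0] Pw]]].
  have {}Pw x : P x -> dot w x < 0.
    by move=> /Pw; rewrite b0; exact: open_halfspace_lt0.
  (* The volume of [P] is a multiple of that of [unit_cone P], which satisfies the same homogeneous
     inequalities. *)
  have [x0 x0P] : exists x0, forall i, dot (v i) x0 < 0.
    apply: (@polytope_interior _ _ _ v (fun=> 0) (unit_cone P)) => [i||].
    - exact: unit_neq0.
    - move=> _ [t [x [t0 _ /PP[_ xP] ->]]] i.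
      by rewrite dotZr mulr_ge0_le0.
    - rewrite lt_neqAle lebesgue_volume_ge0 andbT eq_sym; apply/eqP => U0.
      by move: volP; rewrite /volume U0 mule0 ltxx.
  pose V := \matrix_i v i.
  (* Pairing the relation of absolute values with [x0] gives a zero sum of nonpositive terms, so
     every coefficient is 0. *)
  have Vfree : row_free V.
    apply/inj_row_free => l lV; apply/rowP => i; rewrite mxE.
    have rl : relation v (fun i => l 0 i).
      rewrite /relation -[RHS]lV [RHS]mulmx_sum_row.
      by apply: eq_bigr => j _; rewrite rowK.
    have /eqP := relation_dot x0 (relation_norm vno rl).
    rewrite -oppr_eq0 -sumrN psumr_eq0 => [/allP/(_ i)|j _].
      rewrite mem_index_enum oppr_eq0 mulf_eq0 normr_eq0 (lt_eqF (x0P i)) orbF.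
      by move=> /(_ isT)/eqP.
    by rewrite oppr_ge0 mulr_ge0_le0// ltW.
  (* Otherwise [P] would contain the antipodal points [u] and [- u], both on the negative side of
     [w]. *)
  have vspan z : (forall i, dot (v i) z = 0) -> z = 0.
    move=> vz; apply: contrapT => /eqP z0.
    pose u := (Num.sqrt (dot z z))^-1 *: z.
    have u1 : dot u u = 1 by exact: dot_normalize.
    have vu i : dot (v i) u = 0 by rewrite dotZr vz mulr0.
    have wu : dot w u < 0 by apply/Pw/PP; split=> // i; rewrite vu.
    have : dot w (- u) < 0.
      apply/Pw/PP; split=> [|i]; last by rewrite dotNr vu oppr0.
      by rewrite dotNr dotC dotNr opprK.
    by rewrite dotNr oppr_lt0 => /(lt_trans wu); rewrite ltxx.
  have kn : k = n.+1 := etrans (esym (eqP Vfree)) (rank_separating vspan).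
  subst k; have Vunit : V \in unitmx by rewrite -row_free_unit.
  (* The negated dual basis: [q j] lies on every wall but the [j]-th and inside that half-space.
     Coordinates in this basis are the slacks [- dot (v j) x]. *)
  pose q j := - row j (invmx V)^T.
  have vq i j : dot (v i) (q j) = - (i == j)%:R.
    rewrite dotNr; congr (- _).
    have /matrixP/(_ i j) := mulmxV Vunit; rewrite !mxE => <-.
    by apply: eq_bigr => h _; rewrite !mxE.
  have qspan x : x = \sum_j (- dot (v j) x) *: q j.
    apply/eqP; rewrite -subr_eq0; apply/eqP; apply: vspan => i.
    rewrite dotBr dot_sumr (bigD1 i)//= dotZr vq eqxx mulrNN mulr1.
    rewrite big1 ?addr0 ?subrr// => j; rewrite eq_sym => /negbTE ij.
    by rewrite dotZr vq ij oppr0 mulr0.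
  have q0 j : q j != 0.
    apply/eqP => qj; have /eqP := vq j j.
    by rewrite qj dot0r eqxx eq_sym oppr_eq0 oner_eq0.
  pose s j := Num.sqrt (dot (q j) (q j)).
  have s0 j : 0 < s j by rewrite sqrtr_gt0 dot_gt0.
  pose p j := (s j)^-1 *: q j.
  have pP j : P (p j).
    apply/PP; split=> [|i]; first exact: dot_normalize.
    by rewrite dotZr vq mulr_ge0_le0 ?invr_ge0 ?oppr_le0// ltW.
  have qp j : q j = s j *: p j by rewrite scalerA divff ?scale1r// gt_eqF.
  split=> //; exists p; split.
  - by move=> _ [j _ <-]; case/PP: (pP j).
  (* A normal [u] orthogonal to all [p j] is orthogonal to itself, as the [q j] span. *)
  - move=> [u [b' [[u1 ->] pu]]]; move/eqP: (unit_neq0 _ _ u1); apply.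
    apply: dot_eq0; rewrite {2}[u]qspan dot_sumr big1// => j _.
    rewrite qp 2!dotZr; have [_ ->] := pu (p j) (ex_intro2 _ _ j I erefl).
    by rewrite !mulr0.
  - case: (Ppoly) => _ _ _ [w' [b' [w'1 Pw']]]; exists w', b'; split=> //.
    by move=> _ [j _ <-]; exact: Pw'.
  apply/seteqP; split=> x /=.
    move=> /PP[x1 xP]; split=> //; exists (fun j => - dot (v j) x * s j); split=> //.
      by move=> j; rewrite mulr_ge0 ?oppr_ge0// ltW.
    by rewrite [LHS]qspan; apply: eq_bigr => j _; rewrite qp scalerA.
  move=> [x1 [c [c0 _ xE]]]; apply/PP; split=> // i.
  rewrite xE dot_sumr; apply: sumr_le0 => j _; rewrite dotZr.
  by rewrite mulr_ge0_le0//; case/PP: (pP j).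

(* The Euclidean case *)
have v1 i : dot (v i) (v i) = 1 by case: (va i).
have vno i j : i != j -> dot (v i) (v j) <= 0 by move/vG; rewrite mxE.
have {}PE : P = polytope v a.
  rewrite PE; apply/seteqP; split=> x /=; first by move=> [_ xP] i; case: (xP i I).
  by move=> xP; split=> // i _; split=> //; exact: xP.
case: Ppoly => _ /= Pgt0 Plty _.
have [x0 x0a] : exists x0, forall i, dot (v i) x0 < a i.
  apply: polytope_interior Pgt0; last by rewrite PE.
  by move=> i; exact: unit_neq0.
have vb z : (forall i, dot (v i) z <= 0) -> z = 0.
  by move=> vz; apply: polytope_recession x0a vz _; rewrite -PE.
pose component := fingraph.root (adjacent v).
have compK i : component (component i) = component i.
  exact: (root_root (adjacent_connect_sym v)).
pose roots := [pred c | component c == c].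
pose rt (c : 'I_#|roots|) : 'I_k := enum_val c.
have rtK c : component (rt c) = rt c by apply/eqP; exact: (enum_valP c).
have rt_surj i : exists c, component i = rt c.
  have ir : component i \in roots by rewrite inE compK.
  by exists (enum_rank_in ir (component i)); rewrite /rt enum_rankK_in.
have /choice[B BP] := fun c => component_simplex v1 vno vb (rtK c) x0a.
have [||z zB|f [e [fiso fE]]] := @orthonormal_blocks R n _ _ (fun c => projT2 (B c)).
- by move=> c; case: (BP c).
(* Vectors of component [c'] are orthogonal to those of [c], hence to the rows of the basis of [c];
   these rows are thus annihilated by the basis of [c']. *)
- move=> c c' cc'; have [_ Bc' _ _] := BP c'; have [_ Bc _ _] := BP c.
  apply/row_matrixP => h; rewrite row_mul row0; apply: Bc' => i ic'.
  have : v i *m (projT2 (B c))^T = 0.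
    apply: Bc => j jc; apply: dot_component; rewrite ic' jc.
    by rewrite (inj_eq enum_val_inj).
  move=> /rowP/(_ h); rewrite !mxE => vBh; rewrite -[RHS]vBh.
  by apply: eq_bigr => j _; rewrite !mxE.
(* Each [v i] lies in the span of the block of its component, so [z] is orthogonal to all of them
   and boundedness gives [z = 0]. *)
- apply: vb => i; have [c ic] := rt_surj i; have [_ _ vB _] := BP c.
  by rewrite -(vB _ ic) dot_mulmx zB dot0r.
exists f; split=> //; exists _, _, e.
exists (fun c => [set y | forall i, component i = rt c ->
  dot (v i *m (projT2 (B c))^T) y <= a i]); split=> [c|]; first by case: (BP c).
(* The inequality of [v i] involves only the coordinates of [x] in the block of the component of
   [i]. *)
rewrite -fE; congr image; rewrite PE; apply/seteqP; split=> x /= xP.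
  move=> c i ic; have [_ _ vB _] := BP c.
  by rewrite dotC dot_mulmx trmxK vB// dotC.
move=> i; have [c ic] := rt_surj i; have [_ _ vB _] := BP c.
by have := xP c i ic; rewrite dotC dot_mulmx trmxK vB// dotC.
Qed.
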